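(* Let $(A,\ast)$ be a zinbiel algebra, regarded as an L-dendriform algebra $(A,\rhd_0,\lhd_0)$ by setting $x\rhd_0y=y\lhd_0x=x\ast y$ for all $x,y\in A$. If $(A[\![t]\!],\rhd_t,\lhd_t)$ is an L-dendriform algebra deformation of $(A,\rhd_0,\lhd_0)$, then $(A,\ast,\diamond)$ is a pre-$F$-manifold algebra, where $$x\diamond y:=\frac{x\rhd_ty-y\lhd_tx}{t}\Big|_{t=0}=x\rhd_1y-y\lhd_1x,\qquad x,y\in A.$$
   Context: All vector spaces and (multi)linear maps are over a field $\mathbf{k}$ of characteristic $0$. A zinbiel algebra is a vector space $A$ with a bilinear operation $\ast$ satisfying $x\ast(y\ast z)=(x\ast y+y\ast x)\ast z$. A pre-Lie algebra is a vector space $A$ with a bilinear operation $\diamond$ satisfying $x\diamond(y\diamond z)-(x\diamond y)\diamond z=y\diamond(x\diamond z)-(y\diamond x)\diamond z$. An L-dendriform algebra is a triple $(A,\rhd,\lhd)$ of a vector space $A$ (or a module over $\mathbf{k}[\![t]\!]$, with operations bilinear over it) with bilinear operations $\rhd,\lhd$ such that for all $x,y,z$, with $x\odot y=x\rhd y+x\lhd y$: $$(x\odot y)\rhd z-x\rhd(y\rhd z)=(y\odot x)\rhd z-y\rhd(x\rhd z),\qquad x\rhd(y\lhd z)-(x\rhd y)\lhd z=y\lhd(x\odot z)-(y\lhd x)\lhd z.$$ An L-dendriform algebra deformation of $(A,\rhd_0,\lhd_0)$ consists of $\mathbf{k}[\![t]\!]$-bilinear maps $\rhd_t,\lhd_t:A[\![t]\!]\times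 A[\![t]\!]\to A[\![t]\!]$ of the form $x\rhd_ty=\sum_{i\ge0}(x\rhd_iy)t^i$, $x\lhd_ty=\sum_{i\ge0}(x\lhd_iy)t^i$ for $x,y\in A$ (with bilinear maps $\rhd_i,\lhd_i:A\times A\to A$ and the $i=0$ terms being the given ones) such that $(A[\![t]\!],\rhd_t,\lhd_t)$ is an L-dendriform algebra over $\mathbf{k}[\![t]\!]$. A pre-$F$-manifold algebra is a triple $(A,\ast,\diamond)$ with $(A,\ast)$ a zinbiel algebra and $(A,\diamond)$ a pre-Lie algebra such that for all $x,y,z,w\in A$, with $x\odot y=x\ast y+y\ast x$ and $\{\!\!\{x,y\}\!\!\}=x\diamond y-y\diamond x$: $$F_1(x\odot y,z,w)=x\ast F_1(y,z,w)+y\ast F_1(x,z,w),$$ $$\big(F_1(x,y,z)+F_1(x,z,y)+F_2(y,z,x)\big)\ast w=F_2(y,z,x\ast w)-x\ast F_2(y,z,w),$$ where $F_1(x,y,z)=x\diamond(y\ast z)-y\ast(x\diamond z)-\{\!\!\{x,y\}\!\!\}\ast z$ and $F_2(x,y,z)=x\ast(y\diamond z)+y\ast(x\diamond z)-(x\odot y)\diamond z$. *)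

(* Defs.v *)
From HB Require Import structures.
From mathcomp Require Import all_boot all_algebra.
From mathcomp Require Import boolp.

Set Implicit Arguments.
Unset Strict Implicit.
Unset Printing Implicit Defensive.

Import GRing.Theory.
Local Open Scope ring_scope.

(* [fps V] is V[[t]]: the series \sum_n (s n) t^n is the sequence s of its
   coefficients, n |-> s n. *)
Record fps (V : Type) : Type := Fps { fps_coef :> nat -> V }.

Lemma fpsP (V : Type) (s u : fps V) : (forall n, s n = u n) -> s = u.
Proof.
case: s u => [s] [u] /= su; congr Fps; exact: functional_extensionality_dep.
Qed.

HB.instance Definition _ (V : Type) := gen_eqMixin (fps V).
HB.instance Definition _ (V : Type) := gen_choiceMixin (fps V).

Definition fps_add (V : zmodType) (s u : fps V) : fps V :=
  Fps (fun n => s n + u n).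
Definition fps_opp (V : zmodType) (s : fps V) : fps V := Fps (fun n => - s n).
Definition fps_zero (V : zmodType) : fps V := Fps (fun _ => 0).

Lemma fps_addA (V : zmodType) : associative (@fps_add V).
Proof. by move=> s u v; apply: fpsP => n /=; rewrite addrA. Qed.
Lemma fps_addC (V : zmodType) : commutative (@fps_add V).
Proof. by move=> s u; apply: fpsP => n /=; rewrite addrC. Qed.
Lemma fps_add0 (V : zmodType) : left_id (fps_zero V) (@fps_add V).
Proof. by move=> s; apply: fpsP => n /=; rewrite add0r. Qed.
Lemma fps_addN (V : zmodType) :
  left_inverse (fps_zero V) (@fps_opp V) (@fps_add V).
Proof. by move=> s; apply: fpsP => n /=; rewrite addNr. Qed.

HB.instance Definition _ (V : zmodType) := GRing.isZmodule.Build (fps V)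
  (@fps_addA V) (@fps_addC V) (@fps_add0 V) (@fps_addN V).

Definition fps_const (V : zmodType) (v : V) : fps V :=
  Fps (fun n => if n == 0%N then v else 0).

Definition fps_mul (R : comNzRingType) (a b : fps R) : fps R :=
  Fps (fun n => \sum_(i < n.+1) a i * b (n - i)%N).
Definition fps_scale (R : comNzRingType) (M : lmodType R)
    (a : fps R) (s : fps M) : fps M :=
  Fps (fun n => \sum_(i < n.+1) a i *: s (n - i)%N).

Lemma fps_scale_rev (R : comNzRingType) (M : lmodType R) (a : fps R)
    (s : fps M) n :
  fps_scale a s n = \sum_(i < n.+1) a (n - i)%N *: s i.
Proof.
rewrite /= (reindex_inj rev_ord_inj) /=.
by apply: eq_bigr => i _; rewrite (sub_ordK i).
Qed.

Lemma fps_scaleA (R : comNzRingType) (M : lmodType R) (a b : fps R)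
    (s : fps M) :
  fps_scale a (fps_scale b s) = fps_scale (fps_mul a b) s.
Proof.
apply: fpsP => n; rewrite [RHS]fps_scale_rev.
pose c j l := a j *: (b (n - j - l)%N *: s l).
transitivity (\sum_(j < n.+1) \sum_(l < n.+1 | (l <= n - j)%N) c j l).
  rewrite /fps_scale [LHS]/=; apply: eq_bigr => j _.
  rewrite -[X in _ *: X]/(fps_scale b s (n - j)%N) fps_scale_rev scaler_sumr.
  by rewrite (big_ord_narrow_leq (leq_subr _ _)).
rewrite (exchange_big_dep predT) //=; apply: eq_bigr => l _.
transitivity (\sum_(j < n.+1 | (j <= n - l)%N) c j l).
  apply: eq_bigl => j; rewrite -ltnS -(ltnS j) -!subSn ?leq_ord //.
  by rewrite -subn_gt0 -(subn_gt0 j) -!subnDA addnC.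
rewrite (big_ord_narrow_leq (leq_subr _ _)) scaler_suml.
by apply: eq_bigr => j _; rewrite /c -!subnDA addnC scalerA.
Qed.

Lemma fps_const1_scale (R : comNzRingType) (M : lmodType R) :
  left_id (fps_const 1) (@fps_scale R M).
Proof.
move=> s; apply: fpsP => n /=; rewrite big_ord_recl /= subn0 scale1r.
by rewrite big1 ?addr0 // => i _; rewrite scale0r.
Qed.

Lemma fps_scaleDr (R : comNzRingType) (M : lmodType R) :
  right_distributive (@fps_scale R M) +%R.
Proof.
move=> a s u; apply: fpsP => n /=; rewrite -big_split /=.
by apply: eq_bigr => i _; rewrite scalerDr.
Qed.

Lemma fps_scaleDl (R : comNzRingType) (M : lmodType R) (s : fps M) :
  {morph (@fps_scale R M)^~ s : a b / a + b}.
Proof.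
move=> a b; apply: fpsP => n /=; rewrite -big_split /=.
by apply: eq_bigr => i _; rewrite scalerDl.
Qed.

Lemma fps_mulA (R : comNzRingType) : associative (@fps_mul R).
Proof. by move=> a b c; apply: (@fps_scaleA R R^o). Qed.
Lemma fps_mulC (R : comNzRingType) : commutative (@fps_mul R).
Proof.
move=> a b; apply: fpsP => n; rewrite [LHS](@fps_scale_rev R R^o) /=.
by apply: eq_bigr => i _; apply: mulrC.
Qed.
Lemma fps_mul1 (R : comNzRingType) : left_id (fps_const 1) (@fps_mul R).
Proof. exact: (@fps_const1_scale R R^o). Qed.
Lemma fps_mulDl (R : comNzRingType) : left_distributive (@fps_mul R) +%R.
Proof. by move=> a b c; apply: (@fps_scaleDl R R^o). Qed.
Lemma fps_const1_neq0 (R : comNzRingType) : fps_const (1 : R) != 0.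
Proof.
by apply/eqP => /(congr1 (fun s : fps R => s 0%N)) /eqP; rewrite oner_eq0.
Qed.

HB.instance Definition _ (R : comNzRingType) :=
  GRing.Zmodule_isComNzRing.Build (fps R) (@fps_mulA R) (@fps_mulC R)
    (@fps_mul1 R) (@fps_mulDl R) (@fps_const1_neq0 R).

HB.instance Definition _ (R : comNzRingType) (M : lmodType R) :=
  GRing.Zmodule_isLmodule.Build (fps R) (fps M) (@fps_scaleA R M)
    (@fps_const1_scale R M) (@fps_scaleDr R M) (@fps_scaleDl R M).

Definition fps_t (R : comNzRingType) : fps R := Fps (fun n => (n == 1%N)%:R).

(* Division by t: the constant term is dropped, so this is a true quotient
   exactly when that term vanishes. *)
Definition fps_divt (V : zmodType) (s : fps V) : fps V :=
  Fps (fun n => s n.+1).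

Lemma fps_tscale (R : comNzRingType) (M : lmodType R) (s : fps M) n :
  (fps_t R *: s) n = if n is m.+1 then s m else 0.
Proof.
change ((fps_t R *: s) n) with (fps_scale (fps_t R) s n).
case: n => [|n] /=; first by rewrite big_ord_recl big_ord0 /= scale0r addr0.
rewrite !big_ord_recl /= scale0r add0r scale1r big1 ?addr0 ?subSS ?subn0 //.
by move=> i _; rewrite scale0r.
Qed.

Lemma fps_tscaleK (R : comNzRingType) (M : lmodType R) (s : fps M) :
  fps_divt (fps_t R *: s) = s.
Proof. by apply: fpsP => n; rewrite /= -[LHS]/((fps_t R *: s) n.+1) fps_tscale. Qed.

Lemma fps_divtK (R : comNzRingType) (M : lmodType R) (s : fps M) :
  s 0%N = 0 -> fps_t R *: fps_divt s = s.
Proof. by move=> s0; apply: fpsP => -[|n]; rewrite fps_tscale. Qed.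

(* The two components of [bilinear_for *:%R *:%R f], as a proposition. *)
Definition is_bilinear (R : comNzRingType) (M : lmodType R)
    (f : M -> M -> M) : Prop :=
  (forall y, linear (f ^~ y)) /\ (forall x, linear (f x)).

Record is_zinbiel (R : comNzRingType) (M : lmodType R)
    (star : M -> M -> M) : Prop := IsZinbiel {
  zinbiel_bilinear : is_bilinear star;
  zinbiel_identity : forall x y z,
    star x (star y z) = star (star x y + star y x) z
}.

Record is_prelie (R : comNzRingType) (M : lmodType R)
    (dia : M -> M -> M) : Prop := IsPrelie {
  prelie_bilinear : is_bilinear dia;
  prelie_identity : forall x y z,
    dia x (dia y z) - dia (dia x y) z = dia y (dia x z) - dia (dia y x) z
}.

Record is_Ldendriform (R : comNzRingType) (M : lmodType R)
    (rhd lhd : M -> M -> M) : Prop := IsLdendriform {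
  Ldendriform_rhd_bilinear : is_bilinear rhd;
  Ldendriform_lhd_bilinear : is_bilinear lhd;
  Ldendriform_identity1 : forall x y z,
    let odot u v := rhd u v + lhd u v in
    rhd (odot x y) z - rhd x (rhd y z) = rhd (odot y x) z - rhd y (rhd x z);
  Ldendriform_identity2 : forall x y z,
    let odot u v := rhd u v + lhd u v in
    rhd x (lhd y z) - lhd (rhd x y) z = lhd y (odot x z) - lhd (lhd y x) z
}.

Lemma zinbiel_is_Ldendriform (R : comNzRingType) (M : lmodType R)
    (star : M -> M -> M) :
  is_zinbiel star -> is_Ldendriform star (fun x y => star y x).
Proof.
case=> -[linl linr] zin; split => //.
- by move=> x y z /=; rewrite -!zin !subrr.
- by move=> x y z /=; rewrite -zin.
Qed.

(* [rhdt] and [lhdt] are only prescribed on constant series; by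
   k[[t]]-bilinearity this determines them on all of A[[t]]. *)
Record is_Ldendriform_deformation (k : fieldType) (A : lmodType k)
    (rhd0 lhd0 : A -> A -> A) (rhd lhd : nat -> A -> A -> A)
    (rhdt lhdt : fps A -> fps A -> fps A) : Prop := IsLdendriformDeformation {
  deformation_rhd_bilinear : forall i, is_bilinear (rhd i);
  deformation_lhd_bilinear : forall i, is_bilinear (lhd i);
  deformation_rhd0 : forall x y, rhd 0%N x y = rhd0 x y;
  deformation_lhd0 : forall x y, lhd 0%N x y = lhd0 x y;
  deformation_rhdt : forall x y,
    rhdt (fps_const x) (fps_const y) = Fps (fun i => rhd i x y);
  deformation_lhdt : forall x y,
    lhdt (fps_const x) (fps_const y) = Fps (fun i => lhd i x y);
  deformation_Ldendriform : @is_Ldendriform (fps k) (fps A) rhdt lhdt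
}.

Definition preF_F1 (V : zmodType) (star dia : V -> V -> V) (x y z : V) : V :=
  dia x (star y z) - star y (dia x z) - star (dia x y - dia y x) z.

Definition preF_F2 (V : zmodType) (star dia : V -> V -> V) (x y z : V) : V :=
  star x (dia y z) + star y (dia x z) - dia (star x y + star y x) z.

Record is_preFmanifold (k : fieldType) (A : lmodType k)
    (star dia : A -> A -> A) : Prop := IsPreFmanifold {
  preFmanifold_zinbiel : is_zinbiel star;
  preFmanifold_prelie : is_prelie dia;
  preFmanifold_identity1 : forall x y z w,
    let F1 := preF_F1 star dia in
    F1 (star x y + star y x) z w = star x (F1 y z w) + star y (F1 x z w);
  preFmanifold_identity2 : forall x y z w,
    let F1 := preF_F1 star dia in
    let F2 := preF_F2 star dia in
    star (F1 x y z + F1 x z y + F2 y z x) w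
    = F2 y z (star x w) - star x (F2 y z w)
}.

(* Main.v *)
Require Import Defs.
From mathcomp Require Import all_boot all_algebra.
From mathcomp Require Import boolp.

Set Implicit Arguments.
Unset Strict Implicit.
Unset Printing Implicit Defensive.

Import GRing.Theory.
Local Open Scope ring_scope.

(** Write L_x and D_x for the left multiplications of star and of
    dia = rhd_1 - flip lhd_1, phi for rhd_1, x.y and {x,y} for the
    symmetrization of star and the commutator of dia.

    The operation rhd_t - flip lhd_t is pre-Lie on A[[t]], as for every
    L-dendriform algebra ([vertical_prelie]).  It vanishes modulo t because
    lhd_0 is the flip of rhd_0, so it is t dia + O(t^2), and the t^2
    coefficient of its pre-Lie identity is the pre-Lie identity of dia
    ([prelie_leading]).

    The t coefficient of the second L-dendriform identity says that
    F2(x,y) = L_(dia y x) + Delta(x,y), where the defect Delta(x,y) measures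
    the failure of the zinbiel identity for star + t phi at first order
    ([first_order_F2]).  The defect is a Hochschild coboundary up to operators
    of the form L_a, hence a 2-cocycle up to such operators
    ([defect_cocycle]).

    Since the operators L_x commute with each other, both identities that
    define a pre-F-manifold algebra amount to the same one:
        U(x,y,z) := [F2(x,y), L_z] - L_(x.{y,z} + y.{x,z} - {x.y,z}) = 0.
    Adding the cocycle equation at (x,y,z) to the one at (z,y,x) and using that
    F2 is symmetric gives U(x,y,z) = - U(y,z,x) ([hertling_manin_cyclic]).
    Going three times round the cycle gives U = - U, and U vanishes because 2
    is invertible. *)

(** * Linear identities in abelian groups *)

Inductive zexpr :=
  ZVar of nat | ZZero | ZAdd of zexpr & zexpr | ZOpp of zexpr.

Fixpoint zeval (V : zmodType) (env : seq V) (e : zexpr) : V :=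
  match e with
  | ZVar n => env`_n
  | ZZero => 0
  | ZAdd e1 e2 => zeval env e1 + zeval env e2
  | ZOpp e1 => - zeval env e1
  end.

Fixpoint zcoef (e : zexpr) (i : nat) : int :=
  match e with
  | ZVar n => (i == n)%:Z
  | ZZero => 0
  | ZAdd e1 e2 => zcoef e1 i + zcoef e2 i
  | ZOpp e1 => - zcoef e1 i
  end.

Lemma zeval_coef (V : zmodType) (env : seq V) (e : zexpr) :
  zeval env e = \sum_(i < size env) env`_i *~ zcoef e i.
Proof.
elim: e => [n||e1 IH1 e2 IH2|e IH] /=.
- have [n_lt|n_ge] := ltnP n (size env); last first.
    rewrite nth_default // big1 // => i _.
    by rewrite (ltn_eqF (leq_trans (ltn_ord i) n_ge)).
  rewrite (bigD1 (Ordinal n_lt)) //= eqxx big1 ?addr0 // => i /negPf i_n.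
  by rewrite -val_eqE /= in i_n; rewrite i_n.
- by rewrite big1.
- by rewrite IH1 IH2 -big_split; apply: eq_bigr => i _; rewrite mulrzDr.
- by rewrite IH -sumrN; apply: eq_bigr => i _; rewrite mulrNz.
Qed.

(** The soundness of [abel], which decides equality in the free abelian group
    on the atoms of a goal by comparing integer coefficients. *)
Lemma zeval_eq (V : zmodType) (env : seq V) (e1 e2 : zexpr) :
  all (fun i => zcoef e1 i == zcoef e2 i) (iota 0 (size env)) ->
  zeval env e1 = zeval env e2.
Proof.
move/allP => eq_coef; rewrite !zeval_coef; apply: eq_bigr => i _.
by have := eq_coef i; rewrite mem_iota ltn_ord => /(_ isT)/eqP ->.
Qed.

Ltac zatoms l t :=
  match t with
  | ?a + ?b => let l := zatoms l a in zatoms l b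
  | - ?a => zatoms l a
  | 0 => l
  | _ =>
    let rec add_to m := match m with
      | nil => constr:(t :: l)
      | t :: _ => l
      | _ :: ?m' => add_to m'
      end in add_to l
  end.

Ltac zreify l t :=
  match t with
  | ?a + ?b =>
    let a := zreify l a in let b := zreify l b in constr:(ZAdd a b)
  | - ?a => let a := zreify l a in constr:(ZOpp a)
  | 0 => constr:(ZZero)
  | _ =>
    let rec index m := match m with
      | t :: _ => constr:(0%N)
      | _ :: ?m' => let n := index m' in constr:(S n)
      end in
    let n := index l in constr:(ZVar n)
  end.

Ltac abel :=
  match goal with
  | |- @eq ?V ?a ?b =>
    let l := zatoms (@nil V) a in let l := zatoms l b in
    let ea := zreify l a in let eb := zreify l b in
    apply: (@zeval_eq _ l ea eb); vm_compute; reflexivity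
  end.

(** Adds a known equation to the goal; with [abel], this proves an equation
    that is a sum of known ones. *)
Lemma eq_by (V : zmodType) (x y a b : V) : a = b -> x + b = y + a -> x = y.
Proof. by move=> -> /addIr. Qed.

(** * Bilinear operations *)

Section Bilinear.

Variables (R : comNzRingType) (M : lmodType R) (f : M -> M -> M).
Hypothesis f_bilinear : is_bilinear f.

Lemma bilinearDl x y z : f (x + y) z = f x z + f y z.
Proof. by have := f_bilinear.1 z 1 x y; rewrite /= !scale1r. Qed.

Lemma bilinearDr x y z : f x (y + z) = f x y + f x z.
Proof. by have := f_bilinear.2 x 1 y z; rewrite !scale1r. Qed.

Lemma bilinear0l z : f 0 z = 0.
Proof. by apply: (addrI (f 0 z)); rewrite -bilinearDl !addr0. Qed.

Lemma bilinear0r x : f x 0 = 0.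
Proof. by apply: (addrI (f x 0)); rewrite -bilinearDr !addr0. Qed.

Lemma bilinearZl a x z : f (a *: x) z = a *: f x z.
Proof. by have := f_bilinear.1 z a x 0; rewrite /= bilinear0l !addr0. Qed.

Lemma bilinearZr a x z : f x (a *: z) = a *: f x z.
Proof. by have := f_bilinear.2 x a z 0; rewrite bilinear0r !addr0. Qed.

Lemma bilinearNl x z : f (- x) z = - f x z.
Proof. by rewrite -scaleN1r bilinearZl scaleN1r. Qed.

Lemma bilinearNr x z : f x (- z) = - f x z.
Proof. by rewrite -scaleN1r bilinearZr scaleN1r. Qed.

End Bilinear.

Definition bilinearE (R : comNzRingType) (M : lmodType R) (f : M -> M -> M)
    (f_bil : is_bilinear f) :=
  (bilinearDl f_bil, bilinearDr f_bil, bilinearNl f_bil, bilinearNr f_bil).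

Definition sym2 (V : zmodType) (f : V -> V -> V) x y := f x y + f y x.

Definition bracket (V : zmodType) (f : V -> V -> V) x y := f x y - f y x.

Lemma sym2C (V : zmodType) (f : V -> V -> V) x y : sym2 f x y = sym2 f y x.
Proof. by rewrite /sym2 addrC. Qed.

Lemma bilinear_sub_flip (R : comNzRingType) (M : lmodType R)
    (f g : M -> M -> M) :
  is_bilinear f -> is_bilinear g -> is_bilinear (fun x y => f x y - g y x).
Proof.
move=> f_bil g_bil; split=> [y a u v|x a u v] /=.
all: by rewrite !(bilinearE f_bil, bilinearE g_bil)
  (bilinearZl f_bil, bilinearZr f_bil) (bilinearZl g_bil, bilinearZr g_bil)
  scalerBr; abel.
Qed.

(** Let r_x = rhd x and h_x = lhd _ x, and let c be the commutator of x and y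
    for the sum rhd + lhd.  The first identity reads [r_x, r_y] = r_c, and
    antisymmetrizing the second one in x and y gives
    [r_x, h_y] + [h_x, r_y] - [h_x, h_y] = h_c.  The difference is
    [r_x - h_x, r_y - h_y] = r_c - h_c, which is the pre-Lie identity because c
    is also the commutator of x and y for rhd - flip lhd. *)
Lemma vertical_prelie (R : comNzRingType) (M : lmodType R)
    (rhd lhd : M -> M -> M) :
  is_Ldendriform rhd lhd -> is_prelie (fun x y => rhd x y - lhd y x).
Proof.
case=> r_bil l_bil id1 id2; split; first exact: bilinear_sub_flip.
move=> x y z.
have := id1 x y z; have := id2 x z y; have := id2 y z x.
rewrite /= !(bilinearE r_bil, bilinearE l_bil) => e_yzx e_xzy e_xyz.
apply: (eq_by (esym e_xyz)); apply: (eq_by (esym e_xzy)).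
by apply: (eq_by e_yzx); abel.
Qed.

(** * Low-order coefficients of operations on power series *)

Section Series.

Variables (k : comNzRingType) (A : lmodType k).

Lemma fps_addE (s u : fps A) n : (s + u) n = s n + u n.
Proof. by []. Qed.

Lemma fps_oppE (s : fps A) n : (- s) n = - s n.
Proof. by []. Qed.

Lemma fps_split (s : fps A) : s = fps_const (s 0%N) + fps_t k *: fps_divt s.
Proof.
by apply: fpsP => -[|n]; rewrite fps_addE fps_tscale /= ?addr0 ?add0r.
Qed.

Section Coefficients.

Variables (B : fps A -> fps A -> fps A) (f : nat -> A -> A -> A).
Hypothesis B_bilinear : @is_bilinear (fps k) (fps A) B.
Hypothesis B_const : forall x y,
  B (fps_const x) (fps_const y) = Fps (fun i => f i x y).

Lemma bilinear_coef0 a b : B a b 0%N = f 0%N (a 0%N) (b 0%N).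
Proof.
rewrite {1}(fps_split a) {1}(fps_split b) (bilinearDl B_bilinear).
rewrite (bilinearDr B_bilinear) (bilinearZl B_bilinear).
by rewrite (bilinearZr B_bilinear) B_const !fps_addE !fps_tscale /= !addr0.
Qed.

Lemma bilinear_coef1 a b :
  B a b 1%N = f 1%N (a 0%N) (b 0%N) + f 0%N (a 0%N) (b 1%N)
              + f 0%N (a 1%N) (b 0%N).
Proof.
rewrite {1}(fps_split a) {1}(fps_split b) (bilinearDl B_bilinear).
(* The second factor is put back together in the part t B (divt a) b, of
   which only the constant coefficient matters. *)
rewrite (bilinearDr B_bilinear) (bilinearZl B_bilinear) -fps_split.
rewrite (bilinearZr B_bilinear) B_const !fps_addE !fps_tscale.
by rewrite !bilinear_coef0.
Qed.

End Coefficients.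

(** Here D = t d + O(t^2), so each product of two D's in the pre-Lie identity
    is t^2 times the corresponding product of two d's, modulo t^3. *)
Lemma prelie_leading (D : fps A -> fps A -> fps A) (d : A -> A -> A) :
  @is_prelie (fps k) (fps A) D -> is_bilinear d ->
  (forall a b, D a b 0%N = 0) ->
  (forall a b, D a b 1%N = d (a 0%N) (b 0%N)) ->
  is_prelie d.
Proof.
case=> D_bil D_prelie d_bil D0 D1; split=> // x y z.
have D2l a b c : D (D a b) c 2%N = d (d (a 0%N) (b 0%N)) (c 0%N).
  rewrite -(fps_divtK (D0 a b)) (bilinearZl D_bil) fps_tscale D1 /=.
  by rewrite D1.
have D2r a b c : D a (D b c) 2%N = d (a 0%N) (d (b 0%N) (c 0%N)).
  rewrite -(fps_divtK (D0 b c)) (bilinearZr D_bil) fps_tscale D1 /=.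
  by rewrite D1.
have /(congr1 (fun s : fps A => s 2%N)) :=
  D_prelie (fps_const x) (fps_const y) (fps_const z).
by rewrite !fps_addE !fps_oppE !D2l !D2r.
Qed.

End Series.

(** * The pre-F-manifold identities *)

Section Infinitesimal.

Variables (R : comNzRingType) (A : lmodType R) (star phi : A -> A -> A).
Hypotheses (star_zinbiel : is_zinbiel star) (phi_bilinear : is_bilinear phi).

(** The t coefficient of x (y z) - (x y + y x) z for the product
    star + t phi. *)
Definition zinbiel_defect x y z :=
  phi x (star y z) + star x (phi y z)
  - phi (sym2 star x y) z - star (sym2 phi x y) z.

Let star_phiE := (bilinearE (zinbiel_bilinear star_zinbiel),
  bilinearE phi_bilinear).

Let star_star x y z :
  star x (star y z) = star (star x y) z + star (star y x) z.
Proof. by rewrite (zinbiel_identity star_zinbiel) !star_phiE. Qed.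

(** A is a module over the commutative associative algebra (A, sym2 star) via
    left multiplication.  The first three terms of the defect are the Hochschild
    coboundary of phi, seen as a 1-cochain with values in End A, so that
    their own coboundary is zero; what remains is minus the coboundary of
    sym2 phi, seen as a 2-cochain with values in A. *)
Lemma defect_cocycle x y z w :
  star x (zinbiel_defect y z w) - zinbiel_defect (sym2 star x y) z w
  + zinbiel_defect x (sym2 star y z) w - zinbiel_defect x y (star z w)
  = star (sym2 star (sym2 phi x y) z + sym2 phi (sym2 star x y) z
      - sym2 phi x (sym2 star y z) - sym2 star x (sym2 phi y z)) w.
Proof. by rewrite /zinbiel_defect /sym2 !(star_phiE, star_star); abel. Qed.

Variable dia : A -> A -> A.
Hypothesis dia_bilinear : is_bilinear dia.

Local Notation F1 := (preF_F1 star dia).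
Local Notation F2 := (preF_F2 star dia).

Hypothesis F2_defect : forall x y z,
  F2 x y z = star (dia y x) z + zinbiel_defect x y z.

Let bilE := (star_phiE, bilinearE dia_bilinear).

Lemma preF_F2C x y z : F2 x y z = F2 y x z.
Proof. by rewrite /preF_F2 [star x y + _]addrC [star x _ + _]addrC. Qed.

(** The operator [F2(x,y), L_z] - L_a applied to w, where a is the failure of
    the bracket with z to be a derivation of the symmetrized product. *)
Definition hertling_manin x y z w :=
  F2 x y (star z w) - star z (F2 x y w)
  - star (sym2 star x (bracket dia y z) + sym2 star y (bracket dia x z)
          - bracket dia (sym2 star x y) z) w.

(** In the sum of the cocycle equations at (x,y,z) and (z,y,x) the terms with
    phi cancel, because sym2 phi is symmetric, and the terms F2(x.y, z) and
    F2(x, y.z) cancel by the symmetry of F2; only commutators of F2 with left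
    multiplications and terms with dia are left. *)
Lemma hertling_manin_cyclic x y z w :
  hertling_manin x y z w = - hertling_manin y z x w.
Proof.
have defectE a b c : zinbiel_defect a b c = F2 a b c - star (dia b a) c.
  by rewrite F2_defect; abel.
have := defect_cocycle x y z w; have := defect_cocycle z y x w.
rewrite !defectE (sym2C star z y) (sym2C star y x).
rewrite (preF_F2C (sym2 star y z)) (preF_F2C z (sym2 star x y)).
rewrite (preF_F2C z y) (preF_F2C y x).
(* F2 is made opaque, so that its values are atoms. *)
rewrite /hertling_manin /bracket /sym2; move: (F2) => G.
rewrite !(bilE, star_star) => e_zyx e_xyz.
by apply: (eq_by (esym e_xyz)); apply: (eq_by (esym e_zyx)); abel.
Qed.

Hypothesis two_torsion_free : forall v : A, v + v = 0 -> v = 0.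

Lemma hertling_manin_eq0 x y z w : hertling_manin x y z w = 0.
Proof.
apply: two_torsion_free.
rewrite {1}hertling_manin_cyclic hertling_manin_cyclic.
by rewrite [X in - - X]hertling_manin_cyclic opprK addNr.
Qed.

(** Substituting F1(x,z) = [D_x, L_z] - L_{x,z}, where L_{x,z} is the left
    multiplication by the bracket of x and z, turns the difference of the two
    sides into - [hertling_manin]. *)
Lemma preF_identity1 x y z w :
  F1 (sym2 star x y) z w = star x (F1 y z w) + star y (F1 x z w).
Proof.
have := hertling_manin_eq0 x y z w.
rewrite /hertling_manin /preF_F2 /preF_F1 /bracket /sym2 !(bilE, star_star).
by move=> e; apply: (eq_by (esym e)); abel.
Qed.

(** The factor on the left is the failure of the bracket with x to be a
    derivation at y.z: the three summands add up to
    {x, y.z} - y.{x,z} - z.{x,y}. *)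
Lemma preF_identity2 x y z w :
  star (F1 x y z + F1 x z y + F2 y z x) w
  = F2 y z (star x w) - star x (F2 y z w).
Proof.
have := hertling_manin_eq0 y z x w.
rewrite /hertling_manin /preF_F2 /preF_F1 /bracket /sym2 !(bilE, star_star).
by move=> e; apply: (eq_by (esym e)); abel.
Qed.

End Infinitesimal.

(** * Deformations *)

Section Deformation.

Variables (k : fieldType) (A : lmodType k) (star : A -> A -> A).
Variables (rhd lhd : nat -> A -> A -> A) (rhdt lhdt : fps A -> fps A -> fps A).
Hypothesis star_zinbiel : is_zinbiel star.
Hypothesis deform :
  is_Ldendriform_deformation star (fun x y => star y x) rhd lhd rhdt lhdt.

Let dia x y := rhd 1%N x y - lhd 1%N y x.

Let rhdt_bilinear := Ldendriform_rhd_bilinear (deformation_Ldendriform deform).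
Let lhdt_bilinear := Ldendriform_lhd_bilinear (deformation_Ldendriform deform).

Let rhdt0 a b : rhdt a b 0%N = star (a 0%N) (b 0%N).
Proof.
by rewrite (bilinear_coef0 rhdt_bilinear (deformation_rhdt deform))
  (deformation_rhd0 deform).
Qed.

Let lhdt0 a b : lhdt a b 0%N = star (b 0%N) (a 0%N).
Proof.
by rewrite (bilinear_coef0 lhdt_bilinear (deformation_lhdt deform))
  (deformation_lhd0 deform).
Qed.

Let rhdt1 a b : rhdt a b 1%N =
  rhd 1%N (a 0%N) (b 0%N) + star (a 0%N) (b 1%N) + star (a 1%N) (b 0%N).
Proof.
by rewrite (bilinear_coef1 rhdt_bilinear (deformation_rhdt deform))
  !(deformation_rhd0 deform).
Qed.

Let lhdt1 a b : lhdt a b 1%N =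
  lhd 1%N (a 0%N) (b 0%N) + star (b 0%N) (a 1%N) + star (b 1%N) (a 0%N).
Proof.
by rewrite addrAC (bilinear_coef1 lhdt_bilinear (deformation_lhdt deform))
  !(deformation_lhd0 deform).
Qed.

Lemma first_order_bilinear : is_bilinear dia.
Proof.
exact: bilinear_sub_flip (deformation_rhd_bilinear deform 1)
  (deformation_lhd_bilinear deform 1).
Qed.

Lemma first_order_prelie : is_prelie dia.
Proof.
apply: (prelie_leading (vertical_prelie (deformation_Ldendriform deform))).
- exact: first_order_bilinear.
- by move=> a b; rewrite fps_addE fps_oppE rhdt0 lhdt0 subrr.
- move=> a b; rewrite fps_addE fps_oppE rhdt1 lhdt1.
  by rewrite opprD addrACA subrr addr0 opprD addrACA subrr addr0.
Qed.

(** This is the t coefficient of the second L-dendriform identity at the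
    constants (x, z, y), rewritten through lhd_1 v u = rhd_1 u v - dia u v. *)
Lemma first_order_F2 x y z :
  preF_F2 star dia x y z
  = star (dia y x) z + zinbiel_defect star (rhd 1%N) x y z.
Proof.
have /(congr1 (fun s : fps A => s 1%N)) :=
  Ldendriform_identity2 (deformation_Ldendriform deform)
    (fps_const x) (fps_const z) (fps_const y).
have star_bil := zinbiel_bilinear star_zinbiel.
rewrite /= !(fps_addE, fps_oppE, rhdt0, lhdt0, rhdt1, lhdt1) /=.
rewrite /preF_F2 /zinbiel_defect /sym2 /dia.
rewrite !(bilinear0l star_bil, bilinear0r star_bil, bilinearE star_bil).
rewrite !(bilinearE (deformation_rhd_bilinear deform 1)).
rewrite !(bilinearE (deformation_lhd_bilinear deform 1)).
by move=> e; apply: (eq_by (esym e)); abel.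
Qed.

End Deformation.

Theorem mainTheorem12 (k : fieldType) (k_char0 : [pchar k] =i pred0)
    (A : lmodType k) (star : A -> A -> A) (star_zinbiel : is_zinbiel star)
    (rhd lhd : nat -> A -> A -> A) (rhdt lhdt : fps A -> fps A -> fps A)
    (deform : is_Ldendriform_deformation star (fun x y => star y x)
                rhd lhd rhdt lhdt) :
  let num x y :=
    rhdt (fps_const x) (fps_const y) - lhdt (fps_const y) (fps_const x) in
  let dia x y := fps_divt (num x y) 0%N in
  [/\ forall x y, fps_t k *: fps_divt (num x y) = num x y,
      forall x y, dia x y = rhd 1%N x y - lhd 1%N y x
    & is_preFmanifold star dia].
Proof.
move=> num dia.
have numE x y n : num x y n = rhd n x y - lhd n y x.
  by rewrite /num (deformation_rhdt deform) (deformation_lhdt deform).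
have diaE x y : dia x y = rhd 1%N x y - lhd 1%N y x by apply: numE.
split=> // [x y|].
  apply: fps_divtK.
  by rewrite numE (deformation_rhd0 deform) (deformation_lhd0 deform) subrr.
have -> : dia = (fun x y => rhd 1%N x y - lhd 1%N y x).
  by apply/funext => x; apply/funext => y.
have two_torsion_free (v : A) : v + v = 0 -> v = 0.
  move/eqP; rewrite -mulr2n -scaler_nat scaler_eq0 => /orP[|/eqP //].
  by have := k_char0 2%N; rewrite !inE /= => ->.
have phi_bil := deformation_rhd_bilinear deform 1.
have dia_bil := first_order_bilinear deform.
have F2_defect := first_order_F2 star_zinbiel deform.
split=> //.
- exact: first_order_prelie deform.
- exact: (preF_identity1 star_zinbiel phi_bil dia_bil F2_defect).
- exact: (preF_identity2 star_zinbiel phi_bil dia_bil F2_defect).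
Qed.
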